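(* Let $\pi$ be a torsion-free, virtually poly-$Z$ group of Hirsch length $n$, and let $\beta=\beta_1(\pi;\mathbb{Q})=\dim_{\mathbb{Q}}H_1(\pi;\mathbb{Q})$. Then \[ \mathrm{def}(\pi)\leq n-\binom{\beta}{2}. \] If moreover $\pi$ is poly-$Z$ then it has a presentation with $n$ generators and $\binom{n}{2}$ relations, and so \[ n-\binom{n}{2}\leq \mathrm{def}(\pi). \]
   Context: The deficiency $\mathrm{def}(G)$ of a finitely presentable group $G$ is the maximum, over all finite presentations of $G$, of (number of generators) minus (number of relators). A group is poly-$Z$ if it has a finite subnormal series with all factors infinite cyclic; the number of infinite cyclic factors is its Hirsch length, and the Hirsch length of a virtually poly-$Z$ group is that of any poly-$Z$ subgroup of finite index. *)

(* Defs.v *)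
From HB Require Import structures.
From mathcomp Require Import all_boot all_order all_algebra.
From mathcomp Require Import classical_sets.
From mathcomp Require Import freeg.

Set Implicit Arguments.
Unset Strict Implicit.
Unset Printing Implicit Defensive.

Import GRing.Theory Num.Theory.
Local Open Scope group_scope.
Local Open Scope classical_set_scope.

Section Subgroups.
Context {G : groupType}.
Implicit Types (H K : set G) (x t : G).

Definition expgz x (k : int) : G :=
  match k with Posz m => x ^+ m | Negz m => x ^- m.+1 end.

Definition is_subgroup H :=
  H 1 /\ forall x y, H x -> H y -> H (x * y^-1).

Definition normal_in H K :=
  [/\ is_subgroup H, is_subgroup K, H `<=` K
    & forall h x, H h -> K x -> H (x^-1 * h * x)].

(* For H normal in K: the quotient K/H is infinite cyclic, generated by the
   coset tH. *)
Definition infinite_cyclic_factor H K :=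
  exists2 t, K t &
    (forall x, K x -> exists k : int, H ((expgz t k)^-1 * x)) /\
    (forall k : int, H (expgz t k) -> k = 0%R).

(* H has a series 1 = S_0 <| S_1 <| ... <| S_n = H with infinite cyclic
   factors. *)
Definition polyZ_of_length H (n : nat) :=
  exists S : nat -> set G,
    [/\ S 0%N = [set 1], S n = H
      & forall i : nat, (i < n)%N ->
          normal_in (S i) (S i.+1) /\ infinite_cyclic_factor (S i) (S i.+1)].

Definition finite_index H :=
  is_subgroup H /\
  exists s : seq G, forall x, exists2 y, y \in s & H (y^-1 * x).

End Subgroups.

Definition torsion_free (G : groupType) :=
  forall (x : G) (k : nat), (0 < k)%N -> x ^+ k = 1 -> x = 1.

Definition polyZ (G : groupType) :=
  exists n : nat, polyZ_of_length [set: G] n.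

Definition virtually_polyZ (G : groupType) :=
  exists2 H : set G, finite_index H & exists n : nat, polyZ_of_length H n.

(* The number of factors depends neither on the series nor on the poly-Z
   subgroup of finite index, so n is determined by G. *)
Definition hirsch_length (G : groupType) (n : nat) :=
  exists2 H : set G, finite_index H & polyZ_of_length H n.

(* Words in x_0, ..., x_(g-1); the letter (i, false) is x_i and (i, true) is
   its inverse. *)
Definition word (g : nat) := seq ('I_g * bool).

(* Equality of words in the group < x_0, ..., x_(g-1) | rels >. Relators are
   listed with multiplicity, and may be arbitrary (also non-reduced) words. *)
Inductive pres_eq (g : nat) (rels : seq (word g)) : word g -> word g -> Prop :=
| pres_refl u : pres_eq rels u u
| pres_sym u v : pres_eq rels u v -> pres_eq rels v u
| pres_trans u v w :
    pres_eq rels u v -> pres_eq rels v w -> pres_eq rels u w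
| pres_cancel u v i b :
    pres_eq rels (u ++ [:: (i, b); (i, ~~ b)] ++ v) (u ++ v)
| pres_relator u v r :
    r \in rels -> pres_eq rels (u ++ r ++ v) (u ++ v).

Definition eval_word (G : groupType) (g : nat) (e : 'I_g -> G) (w : word g) : G :=
  \prod_(a <- w) (if a.2 then (e a.1)^-1 else e a.1).

(* x_i |-> e i induces an isomorphism < x_0, ..., x_(g-1) | rels > -> G. *)
Definition presents (G : groupType) (g : nat) (rels : seq (word g))
    (e : 'I_g -> G) :=
  (forall x : G, exists w, eval_word e w = x) /\
  (forall u v, eval_word e u = eval_word e v <-> pres_eq rels u v).

Definition has_presentation (G : groupType) (g r : nat) :=
  exists (rels : r.-tuple (word g)) (e : 'I_g -> G), presents rels e.

(* d is the maximum of g - r over the finite presentations of G; in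
   particular G is finitely presentable. *)
Definition is_deficiency (G : groupType) (d : int) :=
  (exists g r : nat, has_presentation G g r /\ d = (g%:Z - r%:Z)%R) /\
  (forall g r : nat, has_presentation G g r -> (g%:Z - r%:Z <= d)%R).

(* Degrees 1 and 2 of the bar complex computing H_*(G; Q). With trivial
   coefficients the boundary C_1 -> C_0 is zero, so that H_1(G; Q) is the
   cokernel of C_2 -> C_1, [g|h] |-> [h] - [gh] + [g]. *)
Definition bar_boundary2 (G : groupType) :
    {freeg (G * G)%type / rat} -> {freeg G / rat} :=
  fglift (fun p : G * G => (<< p.2 >> - << (p.1 * p.2)%g >> + << p.1 >>)%R).

(* dim_Q (V / W) = b: some family of b vectors is a basis of V modulo the
   subspace W. *)
Definition dim_quotient (V : lmodType rat) (W : set V) (b : nat) :=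
  exists v : 'I_b -> V,
    (forall x : V, exists c : 'I_b -> rat, W (x - \sum_i c i *: v i)%R) /\
    (forall c : 'I_b -> rat, W (\sum_i c i *: v i)%R -> forall i, c i = 0%R).

(* dim_Q H_1(G; Q) = b *)
Definition betti1 (G : groupType) (b : nat) :=
  dim_quotient (range (@bar_boundary2 G)) b.

(* Main.v *)
Require Import Defs.
From mathcomp Require Import freeg.
From mathcomp Require Import all_boot all_order all_algebra.
From mathcomp Require Import boolp classical_sets zify.

Set Implicit Arguments.
Unset Strict Implicit.
Unset Printing Implicit Defensive.

Import Order.TTheory GRing.Theory Num.Theory.

(** Let E be the matrix of exponent sums of a presentation of pi with g
    generators and r relators.  Its kernel embeds in Hom(pi, Q), so
    g - rank E <= beta.  Lift the map phi from the free group to Q^beta to the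
    central extension of Q^beta by the exterior square, of dimension
    'C(beta, 2).  The relators then take central values; changing the central
    coordinates of the generators corrects these values by the image of E, so a
    quotient of the centre of dimension D >= 'C(beta, 2) - (r - rank E) can be
    kept such that the relators become trivial.  The image of pi in that
    nilpotent group has Hirsch length beta + D, which is therefore at most n,
    and g + 'C(beta, 2) <= n + r follows.

    Hirsch lengths are compared through chains of subgroups with successive
    infinite indices.  A presentation with n generators and 'C(n, 2) relators
    arises from a poly-Z series: if the coset of t generates an infinite cyclic
    factor K/H, it suffices to add to a presentation of H the generator t and
    one relator t x t^-1 = w for each generator x of H. *)

Local Open Scope group_scope.
Local Open Scope classical_set_scope.

(** * Hirsch length *)

Section HirschLength.
Context {G : groupType}.
Implicit Types (H K L S : set G) (x y t : G).

Lemma subgroup1 H : is_subgroup H -> H 1.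
Proof. by case. Qed.

Lemma subgroupV H x : is_subgroup H -> H x -> H x^-1.
Proof. by move=> [H1 HH] Hx; rewrite -[x^-1]mul1g; apply: HH. Qed.

Lemma subgroupM H x y : is_subgroup H -> H x -> H y -> H (x * y).
Proof.
by move=> gH Hx Hy; rewrite -[y]invgK; apply: gH.2 => //; apply: subgroupV.
Qed.

Lemma subgroupX H x k : is_subgroup H -> H x -> H (x ^+ k).
Proof.
move=> gH Hx; elim: k => [|k IHk]; first exact: subgroup1.
by rewrite expgS; apply: subgroupM.
Qed.

Lemma subgroupXz H x k : is_subgroup H -> H x -> H (expgz x k).
Proof. by move=> gH Hx; case: k => k /=; [|apply: subgroupV => //]; apply: subgroupX. Qed.

Lemma subgroupMr H x y : is_subgroup H -> H y -> H (x * y) -> H x.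
Proof.
by move=> gH Hy Hxy; rewrite -[x](mulgK y); apply: gH.2.
Qed.

Lemma subgroupI H K : is_subgroup H -> is_subgroup K -> is_subgroup (H `&` K).
Proof.
move=> [H1 HH] [K1 KK]; split=> // x y [Hx Kx] [Hy Ky].
by split; [apply: HH|apply: KK].
Qed.

Lemma expgzS x k : expgz x (k + 1)%R = x * expgz x k.
Proof.
case: k => k; first by rewrite -PoszD addn1 /= expgS.
case: k => [|k]; first by rewrite /= expg1 mulgV.
have -> : (Negz k.+1 + 1)%R = Negz k by rewrite !NegzE -[k.+2]addn1 PoszD opprD addrNK.
by rewrite /= [x ^+ k.+2]expgSr invgM mulVKg.
Qed.

Lemma int_ind1 (P : int -> Prop) :
  P 0%R -> (forall k, P k -> P (k + 1)%R) -> (forall k, P (k + 1)%R -> P k) ->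
  forall k, P k.
Proof.
move=> P0 PS Ppred; case; elim=> [|k IHk] //.
- by rewrite -addn1 PoszD; apply: PS.
- by apply: Ppred.
- by apply: Ppred; rewrite !NegzE -[k.+2]addn1 PoszD opprD addrNK -NegzE.
Qed.

Lemma expgzD x k l : expgz x (k + l)%R = expgz x k * expgz x l.
Proof.
elim/int_ind1: k => [|k IHk|k IHk].
- by rewrite add0r /= mul1g.
- by rewrite addrAC !expgzS IHk mulgA.
- by apply: (mulgI x); rewrite mulgA -!expgzS -IHk addrAC.
Qed.

Lemma expgz1 x : expgz x 1 = x.
Proof. by rewrite /= expg1. Qed.

Lemma expgzN x k : expgz x (- k)%R = (expgz x k)^-1.
Proof. by apply: (mulgI (expgz x k)); rewrite -expgzD subrr mulgV. Qed.

Definition add_hom_on (V : zmodType) K (f : G -> V) :=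
  forall x y, K x -> K y -> f (x * y) = (f x + f y)%R.

Lemma add_hom1 (V : zmodType) K (f : G -> V) : is_subgroup K -> add_hom_on K f -> f 1 = 0%R.
Proof.
move=> gK fM; have K1 := subgroup1 gK.
by apply: (addrI (f 1)); rewrite -fM // mulg1 addr0.
Qed.

Lemma add_homV (V : zmodType) K (f : G -> V) x :
  is_subgroup K -> add_hom_on K f -> K x -> f x^-1 = (- f x)%R.
Proof.
move=> gK fM Kx; apply: (addrI (f x)).
by rewrite -fM ?mulgV ?subrr ?(add_hom1 gK) //; apply: subgroupV.
Qed.

Lemma subgroup_ker (V : zmodType) K (f : G -> V) :
  is_subgroup K -> add_hom_on K f -> is_subgroup (K `&` [set x | f x = 0%R]).
Proof.
move=> gK fM; split; first by split; [exact: subgroup1|exact: add_hom1 fM].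
move=> x y [Kx fx] [Ky fy]; split; first exact: gK.2.
have KVy := subgroupV gK Ky.
by rewrite /= fM // (add_homV gK fM) // fx fy subr0.
Qed.

Lemma add_homX (V : zmodType) K (f : G -> V) x k :
  is_subgroup K -> add_hom_on K f -> K x -> f (x ^+ k) = (f x *+ k)%R.
Proof.
move=> gK fM Kx; elim: k => [|k IHk]; first exact: add_hom1 fM.
by rewrite expgS mulrS fM ?IHk //; apply: subgroupX.
Qed.

Lemma add_homXz (V : zmodType) K (f : G -> V) x k :
  is_subgroup K -> add_hom_on K f -> K x -> f (expgz x k) = (f x *~ k)%R.
Proof.
move=> gK fM Kx; case: k => k /=; first exact: add_homX fM Kx.
rewrite (add_homV gK fM); last exact: subgroupX.
by rewrite (add_homX _ gK fM).
Qed.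

(** The exponent of t in a coset of H is unique because only the zeroth power of t lies in H, and it
    is additive because H is normal. With this degree map, quotients are replaced by kernels. *)
Lemma infinite_cyclic_factor_hom H K :
  normal_in H K -> infinite_cyclic_factor H K ->
  exists f : G -> int, [/\ add_hom_on K f, forall x, K x -> (f x = 0%R <-> H x)
              & exists2 t, K t & f t = 1%R].
Proof.
move=> [gH gK HK nHK] [t Kt [Ht t0]].
have /choice[f Hf] : forall x, exists k, K x -> H ((expgz t k)^-1 * x).
  move=> x; have [/Ht[k Hk]|nKx] := EM (K x); first by exists k.
  by exists 0%R.
have KXt k : K (expgz t k) by apply: subgroupXz.
have f_uniq x k : K x -> H ((expgz t k)^-1 * x) -> f x = k.
  move=> Kx Hk; apply/eqP; rewrite -subr_eq0; apply/eqP/t0.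
  rewrite addrC expgzD expgzN.
  have := gH.2 _ _ Hk (Hf _ Kx); rewrite invgM invgK mulgA.
  by rewrite mulgK.
exists f; split.
- move=> x y Kx Ky; apply: f_uniq; first exact: subgroupM.
  rewrite expgzD invgM.
  have := nHK _ _ (Hf x Kx) (KXt (f y)).
  move=> /(subgroupM gH) /(_ (Hf y Ky)).
  by rewrite -!mulgA mulVKg.
- move=> x Kx; split=> [fx0|Hx]; first by have := Hf x Kx; rewrite fx0 invg1 mul1g.
  by apply: f_uniq => //=; rewrite invg1 mul1g.
- by exists t => //; apply: f_uniq => //; rewrite expgz1 mulVg; apply: subgroup1.
Qed.

(* The coset representatives need not lie in K, so that the notion is inherited
   by smaller K and larger L. *)
Definition finite_index_in L K :=
  exists s : seq G, forall x, K x -> exists2 y, y \in s & L (y^-1 * x).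

Lemma finite_index_in_mono L L' K K' :
  L `<=` L' -> K' `<=` K -> finite_index_in L K -> finite_index_in L' K'.
Proof.
by move=> LL' KK' [s Ls]; exists s => x /KK' /Ls[y ys /LL']; exists y.
Qed.

(** Coset representatives may lie outside the subgroup under study; this trades them for elements
    with a prescribed property wherever such elements exist. *)
Lemma finite_witnesses (T : eqType) (s : seq T) (R : T -> G -> Prop) :
  exists s' : seq G, forall a, a \in s -> (exists x, R a x) ->
    exists2 x, x \in s' & R a x.
Proof.
elim: s => [|a s [s' Hs']]; first by exists [::].
have [[x Rx]|nR] := EM (exists x, R a x).
  exists (x :: s') => b; rewrite inE => /orP[/eqP-> _|/Hs' Rb /Rb[y ys Ry]].
    by exists x; rewrite ?mem_head.
  by exists y; rewrite // inE ys orbT.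
by exists s' => b; rewrite inE => /orP[/eqP->|/Hs'].
Qed.

Lemma finite_index_in_trans L S K :
  is_subgroup K -> is_subgroup S ->
  finite_index_in S K -> finite_index_in L (K `&` S) -> finite_index_in L K.
Proof.
move=> gK gS [s Ss] [s' Ls'].
(* Every coset of S that meets K receives a representative z in K, so that z^-1 x lies in both K and
   S, where s' applies. *)
have [r Hr] := finite_witnesses s (fun y x => K x /\ S (y^-1 * x)).
exists [seq a * b | a <- r, b <- s'] => x Kx.
have [y ys Syx] := Ss x Kx.
have [|z zr [Kz Syz]] := Hr y ys; first by exists x.
have [|b bs Lb] := Ls' (z^-1 * x).
  split; first by apply: subgroupM => //; apply: subgroupV.
  by have := subgroupM gS (subgroupV gS Syz) Syx; rewrite invgM invgK -mulgA mulVKg.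
exists (z * b); first by apply: allpairs_f.
by rewrite invgM -mulgA.
Qed.

(* Multiplication by powers of y reduces the degree f modulo f y, so only
   finitely many degrees have to be covered. *)
Lemma finite_index_in_ker L K (f : G -> int) y :
  is_subgroup K -> add_hom_on K f -> L `<=` K -> is_subgroup L ->
  L y -> f y <> 0%R ->
  finite_index_in (L `&` [set x | f x = 0%R]) (K `&` [set x | f x = 0%R]) ->
  finite_index_in L K.
Proof.
move=> gK fM LK gL Ly fy0 [s Hs].
(* One element of K is kept for each remainder modulo f y that occurs as a degree. *)
have [r Hr] := finite_witnesses (iota 0 `|f y|) (fun (a : nat) x => K x /\ f x = a%:Z%R).
exists [seq a * b | a <- r, b <- s] => x Kx.
have Ky := LK _ Ly.
pose q := (f x %/ f y)%Z.
pose x' := x * expgz y (- q)%R.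
have Lq : L (expgz y (- q)%R) by apply: subgroupXz.
have Kx' : K x' by apply: subgroupM => //; apply: LK.
have fx' : f x' = (f x %% f y)%Z.
  rewrite fM //; last exact: LK.
  by rewrite (add_homXz _ gK fM) // mulrNz -mulrzl /modz intz.
have fynz : f y != 0%R by apply/eqP.
have [m fm] : exists m : nat, f x' = m%:Z%R.
  by have := modz_ge0 (f x) fynz; rewrite -fx'; case: (f x') => // m _; exists m.
have m_in : m \in iota 0 `|f y|.
  rewrite mem_iota add0n /= -ltz_nat -fm fx' abszE.
  exact: ltz_mod.
have [|z zr [Kz fz]] := Hr m m_in; first by exists x'.
have [|b bs [Lb _]] := Hs (z^-1 * x').
  split; first by apply: subgroupM => //; apply: subgroupV.
  rewrite /= fM //; last exact: subgroupV.
  by rewrite (add_homV gK fM) // fz fm addNr.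
exists (z * b); first by apply: allpairs_f.
apply: (subgroupMr gL Lq); rewrite invgM -!mulgA; exact: Lb.
Qed.

(** Pigeonhole: with finitely many representatives, two powers of x share one, and their quotient is
    a positive power of x in L. *)
Lemma infinite_index L K x :
  is_subgroup L -> is_subgroup K -> K x -> (forall k, (0 < k)%N -> ~ L (x ^+ k)) ->
  ~ finite_index_in L K.
Proof.
move=> gL gK Kx xL [s Hs].
have /choice[h hP] : forall k, exists y, y \in s /\ L (y^-1 * x ^+ k).
  by move=> k; have [|y] := Hs (x ^+ k); [exact: subgroupX|exists y].
have : ~~ injectiveb [ffun i : 'I_(size s).+1 => h i].
  apply: contraT; rewrite negbK => /injectiveP hinj.
  have := uniq_leq_size (s1 := codom [ffun i : 'I_(size s).+1 => h i]) (s2 := s).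
  rewrite size_codom card_ord ltnn => -> //.
    by rewrite map_inj_uniq ?enum_uniq.
  by move=> _ /codomP[i ->]; rewrite ffunE; case: (hP i).
move/injectivePn => [i [j ij]]; rewrite !ffunE => hij.
wlog lt_ij : i j ij hij / (i < j)%N.
  move=> WL; have [lt_ij|lt_ji|eq_ij] := ltngtP i j; first exact: (WL i j).
    by apply: (WL j i) => //; rewrite eq_sym.
  by case/eqP: ij; apply: val_inj.
apply: (xL (j - i)%N); first by rewrite subn_gt0.
have := subgroupM gL (subgroupV gL (hP i).2) (hP j).2.
rewrite hij invgM invgK -mulgA mulVKg.
by rewrite -[in x ^+ j](subnKC (ltnW lt_ij)) expgnDr mulKg.
Qed.

(* The Hirsch length of a virtually poly-Z group is the largest k for which the
   group is tall; unlike the length of a series, this depends on the group only. *)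
Fixpoint tall (k : nat) K : Prop :=
  if k is k'.+1 then
    is_subgroup K /\ exists L, [/\ L `<=` K, ~ finite_index_in L K & tall k' L]
  else is_subgroup K.

Lemma tall_subgroup k K : tall k K -> is_subgroup K.
Proof. by case: k => [|k] // []. Qed.

Lemma tall_mono k K K' : is_subgroup K' -> K `<=` K' -> tall k K -> tall k K'.
Proof.
move=> gK' KK'; case: k => [//|k] [gK [L [LK nfi tL]]]; split=> //.
exists L; split=> // [x /LK /KK' //|]; apply: contra_not nfi.
exact: finite_index_in_mono.
Qed.

(** The whole chain is intersected with S. A step that became finite would have been finite before,
    by transitivity through S. *)
Lemma tall_finite_index k K S :
  is_subgroup S -> finite_index_in S [set: G] -> tall k K -> tall k (K `&` S).
Proof.
move=> gS fiS; elim: k K => [|k IHk] K /=; first by move=> gK; apply: subgroupI.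
move=> [gK [L [LK nfi tL]]]; split; first exact: subgroupI.
exists (L `&` S); split; [by move=> x [/LK]| |exact: IHk].
apply: contra_not nfi => fi.
apply: (@finite_index_in_trans _ S) => //.
  by apply: finite_index_in_mono fiS.
by apply: finite_index_in_mono fi.
Qed.

(* Intersecting a chain with the kernel of f can destroy the infinite index of
   one step only, the first one that reaches elements of nonzero degree. *)
Lemma tall_ker k K (f : G -> int) :
  add_hom_on K f -> tall k K -> tall k.-1 (K `&` [set x | f x = 0%R]).
Proof.
elim: k K => [|k IHk] K fM tK; first exact: subgroup_ker (tall_subgroup tK) fM.
have [gK [L [LK nfi tL]]] := tK.
have gL := tall_subgroup tL.
have LfM : add_hom_on L f by move=> x y /LK Kx /LK; apply: fM.
have gKf := subgroup_ker gK fM.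
(* If f vanishes on L, then L lies in the kernel and only the top step is lost. Otherwise the top
   step stays infinite and the loss is passed on to L by induction. *)
have [[y Ly fy]|f0] := EM (exists2 y, L y & f y <> 0%R); last first.
  apply: tall_mono gKf _ tL => x Lx; split; first exact: LK.
  by apply: contrapT => fx; apply: f0; exists x.
case: k IHk tL {tK} => [|k] IHk tL //=.
split=> //; exists (L `&` [set x | f x = 0%R]); split.
- by move=> x [/LK].
- by apply: contra_not nfi => /(finite_index_in_ker gK fM LK gL Ly fy).
- exact: IHk LfM tL.
Qed.

(** The kernel of the degree map of the top factor is the previous term of the series, and passing
    to it costs at most one step of the chain. *)
Lemma tall_le H n k K : polyZ_of_length H n -> K `<=` H -> tall k K -> (k <= n)%N.
Proof.
move=> [S [S0 Sn SZ]]; rewrite -{}Sn.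
elim: n k K SZ => [|n IHn] k K SZ KS tK.
  case: k tK => [//|k] [gK [L [LK nfi tL]]]; case: nfi.
  exists [:: 1] => x /KS; rewrite S0 => ->; exists 1; rewrite ?mem_head //.
  by rewrite mulVg; apply: subgroup1 (tall_subgroup tL).
have [nS Zn] := SZ n (ltnSn n).
have [f [fM f0 _]] := infinite_cyclic_factor_hom nS Zn.
suff : (k.-1 <= n)%N by case: (k).
apply: IHn (K `&` [set x | f x = 0%R]) _ _ _ => [i /ltnW/SZ //||].
  by move=> x [Kx /(f0 _ (KS _ Kx))].
by apply: tall_ker tK => x y /KS Kx /KS; apply: fM.
Qed.

(** The series is itself such a chain: the k-th power of t has degree k, so no positive power falls
    into the smaller term. *)
Lemma polyZ_tall H n : polyZ_of_length H n -> tall n H.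
Proof.
move=> [S [S0 Sn SZ]]; rewrite -{}Sn.
elim: n SZ => [|n IHn] SZ.
  by rewrite /= S0; split=> // x y -> ->; rewrite /= mulgV.
have [nS Zn] := SZ n (ltnSn n).
have [f [fM f0 [t St ft]]] := infinite_cyclic_factor_hom nS Zn.
have [gS gS' SS _] := nS.
split=> //; exists (S n); split=> //; last by apply: IHn => i /ltnW/SZ.
apply: (infinite_index gS gS' St) => k k_gt0 /f0 => /(_ (subgroupX _ gS' St)).
rewrite (add_homX _ gS' fM) // ft => /eqP.
by rewrite natz; case: k k_gt0.
Qed.

Lemma hirsch_tall n k : hirsch_length G n -> tall k [set: G] -> (k <= n)%N.
Proof.
move=> [H [gH fiH] ZH] tk; apply: (tall_le ZH (@subIsetr _ setT H)).
by apply: tall_finite_index => //; case: fiH => s Hs; exists s.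
Qed.

(** A series of the whole group and one of a finite-index subgroup are compared through their
    heights, in both directions. *)
Lemma hirsch_polyZ n m :
  hirsch_length G n -> polyZ_of_length [set: G] m -> m = n.
Proof.
move=> hn Zm; apply/anti_leq/andP; split; first exact: hirsch_tall hn (polyZ_tall Zm).
have [H _ Zn] := hn; exact: (tall_le Zm (@subsetT _ H) (polyZ_tall Zn)).
Qed.

(** The maps are made to vanish one at a time. Each step is infinite since Q is torsion-free, and
    the remaining maps stay independent on the kernel of the first. *)
Lemma tall_add_homs d k K (f : 'I_d -> G -> rat) :
    is_subgroup K -> (forall i, add_hom_on K (f i)) ->
    (forall c : 'I_d -> rat,
       (forall x, K x -> \sum_i c i * f i x = 0)%R -> forall i, c i = 0%R) ->
    tall k (K `&` [set x | forall i, f i x = 0%R]) ->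
  tall (d + k) K.
Proof.
elim: d K f => [|d IHd] K f gK fM f_sep tk.
  by apply: tall_mono gK _ tk => x [].
pose f0 := f ord0; have f0M : add_hom_on K f0 by apply: fM.
have [x0 Kx0 f0x0] : exists2 x, K x & f0 x <> 0%R.
  apply: contrapT => f0K.
  have /(_ _ ord0) := f_sep (fun i : 'I_d.+1 => (i == ord0)%:R%R).
  rewrite eqxx => H; have /eqP : (1 = 0 :> rat)%R; last by rewrite oner_eq0.
  apply: H => x Kx; rewrite (bigD1 ord0) //= big1 ?addr0 => [|i /negPf->]; last first.
    by rewrite mul0r.
  by rewrite mul1r; apply: contrapT => f0x; apply: f0K; exists x.
have gK' := subgroup_ker gK f0M.
split=> //; exists (K `&` [set x | f0 x = 0%R]); split.
- by move=> x [].
- apply: (infinite_index gK' gK Kx0) => m m_gt0 [_ /=].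
  rewrite (add_homX _ gK f0M) // => /eqP; rewrite mulrn_eq0 => /orP[/eqP m0|/eqP //].
  by rewrite m0 in m_gt0.
pose f' i := f (lift ord0 i); apply: (IHd _ f') => // [i x y [Kx _] [Ky _]||].
- exact: fM.
- move=> c' c'0.
  pose F x := (\sum_i c' i * f' i x)%R.
  have FM : add_hom_on K F.
    move=> x y Kx Ky; rewrite -big_split; apply: eq_bigr => i _ /=.
    by rewrite -mulrDr /f' fM.
  have f0x0n : f0 x0 != 0%R by apply/eqP.
  (* A combination that vanishes on the kernel of [f0] is a multiple of [f0]: for f0 x / f0 x0 =
     p/q, the element x^q x0^-p lies in that kernel. *)
  have Ff0 x : K x -> F x = (F x0 / f0 x0 * f0 x)%R.
    move=> Kx; pose r := (f0 x / f0 x0)%R.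
    pose y := expgz x (denq r) * expgz x0 (- numq r)%R.
    have Kxr : K (expgz x (denq r)) by apply: subgroupXz.
    have Kx0r : K (expgz x0 (- numq r)%R) by apply: subgroupXz.
    have hom_y (V : zmodType) (h : G -> V) :
        add_hom_on K h -> h y = (h x *~ denq r - h x0 *~ numq r)%R.
      by move=> hM; rewrite hM // !(add_homXz _ gK hM) // mulrNz.
    have dn0 : (denq r)%:~R%R != 0%R :> rat by rewrite intr_eq0 denq_neq0.
    have : F y = 0%R.
      apply: c'0; split; first exact: subgroupM.
      rewrite /= hom_y // -[(_ *~ denq r)%R]mulrzr -[(_ *~ numq r)%R]mulrzr numqE.
      by rewrite mulrA -mulrBl /r mulrCA divff // mulr1 subrr mul0r.
    rewrite hom_y // -[(_ *~ denq r)%R]mulrzr -[(_ *~ numq r)%R]mulrzr numqE mulrA.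
    rewrite -mulrBl => /eqP.
    rewrite mulf_eq0 (negPf dn0) orbF subr_eq0 => /eqP ->.
    by rewrite mulrAC mulrA.
  have := f_sep (fun i : 'I_d.+1 =>
    if unlift ord0 i is Some j then c' j else - (F x0 / f0 x0))%R.
  move=> H i; have := H _ (lift ord0 i); rewrite liftK; apply=> x Kx.
  rewrite big_ord_recl unlift_none.
  under eq_bigr => j _ do rewrite liftK.
  by rewrite -/(F x) (Ff0 _ Kx) mulNr addNr.
- apply: tall_mono tk; last first.
    by move=> x [Kx fx]; split; [split=> //; exact: fx|move=> i; apply: fx].
  (* Gathering the maps into one row vector makes the common kernel the kernel of a single additive
     map. *)
  have -> : (K `&` [set x | f0 x = 0%R] `&` [set x | forall i, f' i x = 0%R]) =
      K `&` [set x | (\row_i f i x = 0 :> 'rV_d.+1)%R].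
    apply/seteqP; split=> x.
      move=> [[Kx fx0] fx]; split=> //; apply/rowP => i; rewrite !mxE.
      by case: (unliftP ord0 i) => [j|] ->; [apply: fx|].
    by move=> [Kx /rowP fx]; split; [split=> //|move=> i];
      [have := fx ord0|have := fx (lift ord0 i)]; rewrite !mxE.
  apply: subgroup_ker => // x y Kx Ky; apply/rowP => i; rewrite !mxE; exact: fM.
Qed.

End HirschLength.

(** * Presentations *)

Section Words.
Variables (g : nat) (rels : seq (word g)).
Implicit Types u v w : word g.

Definition word_inv w : word g := [seq (a.1, ~~ a.2) | a <- rev w].

Lemma word_invK : involutive word_inv.
Proof.
move=> w; rewrite /word_inv -map_rev revK -map_comp -[RHS]map_id.
by apply: eq_map => -[i b] /=; rewrite negbK.
Qed.

Lemma pres_cat u u' v v' :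
  pres_eq rels u u' -> pres_eq rels v v' -> pres_eq rels (u ++ v) (u' ++ v').
Proof.
move=> uu' vv'; apply: (@pres_trans _ _ _ (u' ++ v)).
  elim: uu' => {u u'} [u|u w _|u1 u2 u3 _ H1 _ H2|u w i b|u w r rr].
  - exact: pres_refl.
  - exact: pres_sym.
  - exact: pres_trans H1 H2.
  - by rewrite -!catA; exact: pres_cancel.
  - by rewrite -!catA; apply: pres_relator.
elim: vv' => {v v'} [v|v w _|v1 v2 v3 _ H1 _ H2|v w i b|v w r rr].
- exact: pres_refl.
- exact: pres_sym.
- exact: pres_trans H1 H2.
- by rewrite !(catA u' v); exact: pres_cancel.
- by rewrite !(catA u' v); apply: pres_relator.
Qed.

Lemma pres_catl p u v : pres_eq rels u v -> pres_eq rels (p ++ u) (p ++ v).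
Proof. exact/pres_cat/pres_refl. Qed.

Lemma pres_catr p u v : pres_eq rels u v -> pres_eq rels (u ++ p) (v ++ p).
Proof. by move/pres_cat; apply; apply: pres_refl. Qed.

Lemma pres_mulV w : pres_eq rels (w ++ word_inv w) [::].
Proof.
elim: w => [|[i b] w IHw]; first exact: pres_refl.
rewrite /word_inv rev_cons map_rcons -/(word_inv w) -cats1 -cat1s catA -catA.
apply: (@pres_trans _ _ _ [:: (i, b); (i, ~~ b)]).
  rewrite -[X in pres_eq _ _ X]/([:: (i, b)] ++ [::] ++ [:: (i, ~~ b)]).
  by rewrite -catA; apply: pres_catl; rewrite catA; apply: pres_catr.
exact: (pres_cancel rels [::] [::] i b).
Qed.

Lemma pres_Vmul w : pres_eq rels (word_inv w ++ w) [::].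
Proof. by rewrite -{2}[w]word_invK; apply: pres_mulV. Qed.

Lemma pres_div u v : pres_eq rels (u ++ word_inv v) [::] -> pres_eq rels u v.
Proof.
move=> uv; apply: (@pres_trans _ _ _ (u ++ word_inv v ++ v)); last first.
  by rewrite catA; apply: (pres_catr v uv).
by rewrite -{1}[u]cats0; apply/pres_catl/pres_sym/pres_Vmul.
Qed.

Lemma pres_mem r : r \in rels -> pres_eq rels r [::].
Proof. by move=> rr; have := pres_relator [::] [::] rr; rewrite /= cats0. Qed.

Lemma pres_mem_div u v : u ++ word_inv v \in rels -> pres_eq rels u v.
Proof. by move/pres_mem/pres_div. Qed.

End Words.

Section Evaluation.
Variables (G : groupType) (g : nat) (e : 'I_g -> G).
Implicit Types u v w : word g.

Lemma eval_word_nil : eval_word e [::] = 1.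
Proof. exact: big_nil. Qed.

Lemma eval_word_cat u v : eval_word e (u ++ v) = eval_word e u * eval_word e v.
Proof. exact: big_cat. Qed.

Lemma eval_word_letter i b : eval_word e [:: (i, b)] = if b then (e i)^-1 else e i.
Proof. exact: big_seq1. Qed.

Lemma eval_word_inv w : eval_word e (word_inv w) = (eval_word e w)^-1.
Proof.
elim: w => [|[i b] w IHw]; first by rewrite eval_word_nil invg1.
rewrite /word_inv rev_cons map_rcons -/(word_inv w) -cats1 eval_word_cat IHw.
rewrite -[(i, b) :: w]cat1s eval_word_cat invgM !eval_word_letter; congr (_ * _).
by case: b; rewrite /= ?invgK.
Qed.

Lemma pres_eq_eval (rels : seq (word g)) u v :
  (forall r, r \in rels -> eval_word e r = 1) ->
  pres_eq rels u v -> eval_word e u = eval_word e v.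
Proof.
move=> rels1; elim=> {u v} [//|u v _ ->//|u v w _ -> _ ->//|u v i b|u v r rr].
  rewrite !eval_word_cat -[[:: (i, b); _]]cat1s eval_word_cat !eval_word_letter.
  by case: b; rewrite /= ?mulgV ?mulVg mul1g.
by rewrite !eval_word_cat (rels1 r) // mul1g.
Qed.

End Evaluation.

Definition map_word (g g' : nat) (h : 'I_g -> 'I_g') (w : word g) : word g' :=
  [seq (h a.1, a.2) | a <- w].

Lemma map_word_cat g g' (h : 'I_g -> 'I_g') u v :
  map_word h (u ++ v) = map_word h u ++ map_word h v.
Proof. exact: map_cat. Qed.

Lemma pres_map_word g g' (h : 'I_g -> 'I_g') rels rels' u v :
  {subset [seq map_word h r | r <- rels] <= rels'} ->
  pres_eq rels u v -> pres_eq rels' (map_word h u) (map_word h v).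
Proof.
move=> sub; elim=> {u v} [u|u v _|u v w _ H1 _ H2|u v i b|u v r rr].
- exact: pres_refl.
- exact: pres_sym.
- exact: pres_trans H1 H2.
- rewrite !map_word_cat; exact: pres_cancel.
- by rewrite !map_word_cat; apply/pres_relator/sub/map_f.
Qed.

Lemma eval_map_word (G : groupType) g g' (h : 'I_g -> 'I_g') (e : 'I_g' -> G) w :
  eval_word e (map_word h w) = eval_word (e \o h) w.
Proof. by rewrite /eval_word big_map. Qed.

(** Generators are elements of the ambient group, so that the terms of a series are presented
    without becoming groups of their own. *)
Definition presents_subgroup (G : groupType) (H : set G) (g : nat)
    (rels : seq (word g)) (e : 'I_g -> G) :=
  (forall x, H x <-> exists w, eval_word e w = x) /\
  (forall u v, eval_word e u = eval_word e v <-> pres_eq rels u v).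

Lemma presents_setT (G : groupType) g (rels : seq (word g)) (e : 'I_g -> G) :
  presents_subgroup [set: G] rels e -> presents rels e.
Proof. by move=> [gen eqP]; split=> // x; apply/gen. Qed.

Section Extension.
Variables (G : groupType) (H : set G) (g : nat) (rels : seq (word g)) (e : 'I_g -> G).
Hypothesis presH : presents_subgroup H rels e.

Lemma presents_subgroup1 : H 1.
Proof. by apply/presH.1; exists [::]; rewrite eval_word_nil. Qed.

Lemma presents_relator r : r \in rels -> eval_word e r = 1.
Proof. by move/pres_mem/presH.2; rewrite eval_word_nil. Qed.

(** A word of value 1 takes its value in H, hence reduces to a word in the old generators, and there
    the old relators decide. *)
Lemma presents_overgroup (K : set G) g' (h : 'I_g -> 'I_g')
    (rels' : seq (word g')) (e' : 'I_g' -> G) :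
    e' \o h =1 e ->
    {subset [seq map_word h r | r <- rels] <= rels'} ->
    (forall r, r \in rels' -> eval_word e' r = 1) ->
    (forall w, H (eval_word e' w) -> exists u, pres_eq rels' w (map_word h u)) ->
    (forall x, K x <-> exists w, eval_word e' w = x) ->
  presents_subgroup K rels' e'.
Proof.
move=> e'h sub rels'1 red gen.
have eval_h w : eval_word e' (map_word h w) = eval_word e w.
  by rewrite eval_map_word; apply: eq_bigr => a _; rewrite e'h.
split=> // u v; split; last exact: pres_eq_eval.
move=> uv; apply: pres_div.
have uv1 : eval_word e' (u ++ word_inv v) = 1.
  by rewrite eval_word_cat eval_word_inv uv mulgV.
have [|z uvz] := red (u ++ word_inv v); first by rewrite uv1; apply: presents_subgroup1.
apply: pres_trans (uvz) (pres_map_word sub (v := [::]) _).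
by apply/presH.2; rewrite eval_word_nil -eval_h -uv1 (pres_eq_eval rels'1 uvz).
Qed.

End Extension.

Lemma map_word_inv g g' (h : 'I_g -> 'I_g') w :
  map_word h (word_inv w) = word_inv (map_word h w).
Proof. by rewrite /map_word /word_inv -!map_rev -!map_comp. Qed.

Lemma eval_word_subgroup (G : groupType) (K : set G) g (e : 'I_g -> G) w :
  is_subgroup K -> (forall i, K (e i)) -> K (eval_word e w).
Proof.
move=> gK Ke; elim: w => [|[i b] w IHw]; first by rewrite eval_word_nil; apply: subgroup1.
rewrite -cat1s eval_word_cat eval_word_letter; apply: subgroupM => //.
by case: b => //; apply: subgroupV.
Qed.

Lemma eval_word_nseq (G : groupType) g (e : 'I_g -> G) m i b :
  eval_word e (nseq m (i, b)) = (if b then (e i)^-1 else e i) ^+ m.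
Proof.
elim: m => [|m IHm]; first exact: eval_word_nil.
by rewrite expgS -IHm -eval_word_letter -eval_word_cat.
Qed.

(** * Presentations of extensions with infinite cyclic quotient *)

Section CyclicExtension.
Variables (G : groupType) (H K : set G) (g : nat) (rels : seq (word g)) (e : 'I_g -> G).
Variables (t : G) (s : 'I_g -> word g).
Hypothesis presH : presents_subgroup H rels e.
Hypothesis conj_s : forall j, eval_word e (s j) = t * e j * t^-1.
Hypothesis conj_t : forall x, H x -> H (t^-1 * x * t).
Hypothesis t_order : forall k, (0 < k)%N -> ~ H (t ^+ k).

Let up := map_word (@lift g.+1 ord0).

Definition cyclic_extension_gen (i : 'I_g.+1) : G :=
  if unlift ord0 i is Some j then e j else t.

(* Relators for t^-1 x_j t are superfluous: conjugation by t is onto H. *)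
Definition conj_relator j : word g.+1 :=
  [:: (ord0, false); (lift ord0 j, false); (ord0, true)] ++ word_inv (up (s j)).

Definition cyclic_extension_rels :=
  [seq up r | r <- rels] ++ [seq conj_relator j | j <- enum 'I_g].

Let e' := cyclic_extension_gen.
Let rels' := cyclic_extension_rels.

Definition conj_word (w : word g) : word g :=
  flatten [seq (if a.2 then word_inv (s a.1) else s a.1) | a <- w].

Let e'_t : e' ord0 = t.
Proof. by rewrite /e' /cyclic_extension_gen unlift_none. Qed.

Let e'_lift : e' \o lift ord0 =1 e.
Proof. by move=> j; rewrite /e' /cyclic_extension_gen /= liftK. Qed.

Let eval_up w : eval_word e' (up w) = eval_word e w.
Proof. by rewrite eval_map_word; apply: eq_bigr => a _; rewrite e'_lift. Qed.

Let sub_rels : {subset [seq up r | r <- rels] <= rels'}.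
Proof. by move=> r rr; rewrite mem_cat rr. Qed.

Let eval_rels' r : r \in rels' -> eval_word e' r = 1.
Proof.
rewrite mem_cat => /orP[/mapP[r' rr' ->]|/mapP[j _ ->]].
  by rewrite eval_up (presents_relator presH).
rewrite eval_word_cat eval_word_inv eval_up conj_s.
rewrite -cat1s -[[:: _; (ord0, true)]]cat1s !eval_word_cat !eval_word_letter.
by rewrite -[e' (lift _ _)]/((e' \o lift ord0) j) e'_lift e'_t mulgA mulgV.
Qed.

Lemma eval_conj_word w : eval_word e (conj_word w) = t * eval_word e w * t^-1.
Proof.
elim: w => [|[i b] w IHw]; first by rewrite eval_word_nil mulg1 mulgV.
rewrite /conj_word /= eval_word_cat -/(conj_word w) IHw -[_ :: w]cat1s eval_word_cat.
have -> : eval_word e (if b then word_inv (s i) else s i) = t * eval_word e [:: (i, b)] * t^-1.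
  rewrite eval_word_letter; case: b => //.
  by rewrite eval_word_inv conj_s !invgM invgK mulgA.
by rewrite !mulgA mulgVK.
Qed.

Let pres_t_letter i b : pres_eq rels'
  ((ord0, false) :: up [:: (i, b)]) (up (conj_word [:: (i, b)]) ++ [:: (ord0, false)]).
Proof.
have tsi : pres_eq rels' [:: (ord0, false); (lift ord0 i, false); (ord0, true)] (up (s i)).
  apply: pres_mem_div; have : conj_relator i \in rels'; last by [].
  by rewrite mem_cat orbC map_f // mem_enum.
have {}tsi : pres_eq rels' [:: (ord0, false); (lift ord0 i, false)]
    (up (s i) ++ [:: (ord0, false)]).
  apply: pres_trans (pres_catr _ tsi); apply: pres_sym.
  exact: (pres_cancel _ [:: (ord0, false); (lift ord0 i, false)] [::] _ true).
case: b; rewrite /conj_word /= cats0 //.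
rewrite /up map_word_inv -/up.
(* For an inverse letter: s^-1 t = s^-1 (t x) x^-1 = s^-1 (s t) x^-1 = t x^-1. *)
apply: pres_sym; apply: (@pres_trans _ _ _
    (word_inv (up (s i)) ++ [:: (ord0, false); (lift ord0 i, false)] ++
       [:: (lift ord0 i, true)])).
  apply/pres_catl/pres_sym.
  exact: (pres_cancel _ [:: (ord0, false)] [::] _ false).
rewrite catA; apply: (@pres_trans _ _ _
    ((word_inv (up (s i)) ++ up (s i) ++ [:: (ord0, false)]) ++ [:: (lift ord0 i, true)])).
  exact/pres_catr/pres_catl.
rewrite catA -catA; exact: pres_catr (pres_Vmul _ _).
Qed.

Let pres_t_word u :
  pres_eq rels' ((ord0, false) :: up u) (up (conj_word u) ++ [:: (ord0, false)]).
Proof.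
elim: u => [|[i b] u IHu]; first exact: pres_refl.
apply: (@pres_trans _ _ _ (up (conj_word [:: (i, b)]) ++ (ord0, false) :: up u)).
  rewrite -[X in pres_eq _ _ (_ ++ X)]cat1s catA.
  exact: (pres_catr (up u) (pres_t_letter i b)).
rewrite /conj_word /= cats0 /up map_word_cat -catA.
exact: pres_catl.
Qed.

(** Moving t^-1 to the left uses u t^-1 = t^-1 (t u t^-1). For t, a word u' is first chosen in H
    with value t^-1 u t; the relators of H then identify its conjugate with u. *)
Let pres_word_t u b : exists u',
  pres_eq rels' (up u ++ [:: (ord0, b)]) ((ord0, b) :: up u').
Proof.
case: b.
  exists (conj_word u).
  apply: (@pres_trans _ _ _
      ([:: (ord0, true)] ++ ((ord0, false) :: up u) ++ [:: (ord0, true)])).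
    apply/pres_sym; exact: (pres_cancel _ [::] (up u ++ [:: (ord0, true)]) _ true).
  apply: (@pres_trans _ _ _ ([:: (ord0, true)] ++
      (up (conj_word u) ++ [:: (ord0, false)]) ++ [:: (ord0, true)])).
    exact/pres_catl/pres_catr.
  rewrite -[X in pres_eq _ _ X]cat1s; apply: pres_catl.
  rewrite -catA -[X in pres_eq _ _ X]cats0; apply: pres_catl.
  exact: (pres_cancel _ [::] [::] _ false).
have [u' u'E] : exists u', eval_word e u' = t^-1 * eval_word e u * t.
  by apply/presH.1/conj_t/presH.1; exists u.
exists u'; apply: pres_sym; apply: (pres_trans (pres_t_word u')).
apply/pres_catr/(pres_map_word sub_rels)/presH.2.
by rewrite eval_conj_word u'E !mulgA mulgV mul1g mulgK.
Qed.

Let pres_word_nseq u m b : exists u',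
  pres_eq rels' (up u ++ nseq m (ord0, b)) (nseq m (ord0, b) ++ up u').
Proof.
elim: m u => [|m IHm] u; first by exists u; rewrite cats0; apply: pres_refl.
have [u1 uu1] := pres_word_t u b; have [u2 u12] := IHm u1.
exists u2; rewrite -[nseq m.+1 _]/([:: _] ++ nseq m _) catA.
apply: pres_trans (pres_catr _ uu1) _.
exact: (pres_catl [:: (ord0, b)] u12).
Qed.

Let pres_normal_form w : exists m b u,
  pres_eq rels' w (nseq m (ord0, b) ++ up u).
Proof.
elim: w => [|[i b'] w [m [b [u wE]]]].
  by exists 0%N, true, [::]; apply: pres_refl.
case: (unliftP ord0 i) => [j|] ->.
  have [u' u'E] := pres_word_nseq [:: (j, b')] m b.
  exists m, b, (u' ++ u); rewrite -cat1s.
  apply: pres_trans (pres_catl _ wE) _.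
  by rewrite /up map_word_cat !catA; apply: pres_catr.
have {}wE := pres_catl [:: (ord0, b')] wE.
have [eq_b|neq_b] := eqVneq b' b.
  by exists m.+1, b, u; rewrite -eq_b in wE *.
case: m wE => [|m] wE; first by exists 1%N, b', u.
exists m, b, u; apply: pres_trans wE _.
have -> : b = ~~ b' by case: (b) (b') neq_b => [] [].
exact: (pres_cancel _ [::] _ _ b').
Qed.

Lemma presents_cyclic_extension :
    is_subgroup H -> is_subgroup K -> H `<=` K -> K t ->
    (forall x, K x -> exists k : int, H ((expgz t k)^-1 * x)) ->
  presents_subgroup K cyclic_extension_rels cyclic_extension_gen.
Proof.
move=> gH gK HK Kt Kgen; apply: (presents_overgroup presH e'_lift sub_rels).
- exact: eval_rels'.
(* A normal form with value in H has exponent 0 in t, by [t_order], and is then a word in the old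
   generators. *)
- move=> w; have [[|m] [b [u wE]]] := pres_normal_form w; first by exists u.
  rewrite (pres_eq_eval eval_rels' wE) eval_word_cat eval_up eval_word_nseq e'_t => Hw.
  have Hu : H (eval_word e u) by apply/presH.1; exists u.
  have := subgroupMr gH Hu Hw.
  case: b {wE Hw} => Htm; case: (@t_order m.+1) => //.
  by have := subgroupV gH Htm; rewrite expVgn invgK.
- move=> x; split=> [Kx|[w <-]].
    have [k /presH.1[u uE]] := Kgen x Kx.
    (* For [Negz m] the absolute value is m + 1, matching the exponent in [expgz]. *)
    pose tk : word g.+1 :=
      if k is Posz m then nseq m (ord0, false) else nseq `|k| (ord0, true).
    exists (tk ++ up u); rewrite eval_word_cat eval_up uE.
    have -> : eval_word e' tk = expgz t k.
      by rewrite /tk; case: (k) => m; rewrite eval_word_nseq e'_t //= -expVgn.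
    by rewrite mulVKg.
  apply: eval_word_subgroup gK _ => i; rewrite /e' /cyclic_extension_gen.
  case: (unliftP ord0 i) => [j _|_ //]; apply/HK/presH.1.
  by exists [:: (j, false)]; rewrite eval_word_letter.
Qed.

End CyclicExtension.

(** Each factor adds one generator and one relator per earlier generator; the relator count grows by
    n, as 'C(n, 2) does by Pascal's rule. *)
Lemma polyZ_presentation (G : groupType) (H : set G) n :
  polyZ_of_length H n ->
  exists (rels : seq (word n)) (e : 'I_n -> G),
    size rels = 'C(n, 2) /\ presents_subgroup H rels e.
Proof.
move=> [S [S0 Sn SZ]]; rewrite -{}Sn.
elim: n SZ => [|n IHn] SZ.
  exists [::], (fun=> 1); split=> //; split.
    move=> x; rewrite S0; split=> [->|[w <-]]; first by exists [::]; rewrite eval_word_nil.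
    by case: w => [|[[]]//]; rewrite eval_word_nil.
  by move=> [|[[]]//] [|[[]]//]; split=> // _; apply: pres_refl.
have [|rels [e [sz_rels presS]]] := IHn; first by move=> i /ltnW/SZ.
have [[gS gS' SS nS] [t St [Sgen St0]]] := SZ n (ltnSn n).
have /choice[s sE] : forall j, exists w, eval_word e w = t * e j * t^-1.
  move=> j; apply/presS.1; rewrite -{1}[t]invgK.
  apply: nS; last exact: subgroupV.
  by apply/presS.1; exists [:: (j, false)]; rewrite eval_word_letter.
exists (cyclic_extension_rels rels s), (cyclic_extension_gen e t); split.
  by rewrite size_cat 2!size_map size_enum_ord sz_rels binS bin1 addnC.
apply: (presents_cyclic_extension presS sE) => // [x /nS|k k_gt0 /(St0 k) [k0]].
  exact.
by rewrite k0 in k_gt0.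
Qed.

(** * Presentations of finite-index overgroups *)

Section FiniteIndexOvergroup.
Variables (G : groupType) (H : set G) (g : nat) (rels : seq (word g)) (e : 'I_g -> G).
Hypothesis presH : presents_subgroup H rels e.

Lemma finite_index_presentation :
  finite_index H ->
  exists (g' : nat) (rels' : seq (word g')) (e' : 'I_g' -> G),
    presents_subgroup [set: G] rels' e'.
Proof.
move=> [gH [s Hs]].
pose k := size s; pose y (j : 'I_k) := nth 1 s j.
(* Every element is a coset representative times a word in H; [F] records this decomposition for a
   letter times a representative, [l0] and [u0] for 1. *)
have yP x : exists lu : 'I_k * word g, x = y lu.1 * eval_word e lu.2.
  have [z zs /presH.1[u uE]] := Hs x.
  have zk : (index z s < k)%N by rewrite index_mem.
  by exists (Ordinal zk, u); rewrite /y /= nth_index // uE mulVKg.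
pose e' (i : 'I_(g + k)) := match split i with inl a => e a | inr j => y j end.
pose up := map_word (@lshift g k).
pose c (j : 'I_k) : word (g + k) := [:: (rshift g j, false)].
have e'_l : e' \o lshift k =1 e by move=> i; rewrite /e' /= (unsplitK (inl i)).
have e'_r j : eval_word e' (c j) = y j.
  by rewrite eval_word_letter /e' (unsplitK (inr j)).
have eval_up w : eval_word e' (up w) = eval_word e w.
  by rewrite eval_map_word; apply: eq_bigr => a _; rewrite e'_l.
have /choice[F FE] : forall p : ('I_(g + k) * bool) * 'I_k, exists lu : 'I_k * word g,
    eval_word e' (p.1 :: c p.2) = y lu.1 * eval_word e lu.2 by move=> p; apply: yP.
have [[l0 u0] l0E] := yP 1.
have /choice[U UE] : forall j, exists u, H (y j) -> eval_word e u = y j.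
  move=> j; have [Hj|nHj] := EM (H (y j)); last by exists [::].
  by have /presH.1[u uE] := Hj; exists u.
(* R0 and R1 rewrite every word as y j followed by a word in the generators of
   H; R2 eliminates y j when it lies in H. *)
pose R1 := [seq (p.1 :: c p.2) ++ word_inv (c (F p).1 ++ up (F p).2)
             | p <- enum {: ('I_(g + k) * bool) * 'I_k}].
pose R2 := [seq c j ++ word_inv (up (U j)) | j <- enum 'I_k & `[< H (y j) >]].
pose R0 := [:: c l0 ++ up u0].
pose rels' := [seq up r | r <- rels] ++ R0 ++ R1 ++ R2.
have R0P : pres_eq rels' [::] (c l0 ++ up u0).
  by apply/pres_sym/pres_mem; rewrite !mem_cat mem_head orbT.
have R1P a j : pres_eq rels' (a :: c j) (c (F (a, j)).1 ++ up (F (a, j)).2).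
  apply: pres_mem_div; rewrite !mem_cat; apply/orP; right; apply/orP; right; apply/orP; left.
  by apply/mapP; exists (a, j) => //; rewrite mem_enum.
have R2P j : H (y j) -> pres_eq rels' (c j) (up (U j)).
  move=> Hj; apply: pres_mem_div; rewrite !mem_cat; do 3 (apply/orP; right).
  by apply/mapP; exists j => //; rewrite mem_filter mem_enum andbT; apply/asboolP.
(* Letters are absorbed from the left, starting from the decomposition of 1. *)
have nf w : exists j u, pres_eq rels' w (c j ++ up u).
  elim: w => [|a w [j [u wE]]]; first by exists l0, u0.
  exists (F (a, j)).1, ((F (a, j)).2 ++ u).
  apply: (@pres_trans _ _ _ ((a :: c j) ++ up u)).
    exact: (pres_catl [:: a] wE).
  by rewrite /up map_word_cat catA; apply: pres_catr.
have rels'1 r : r \in rels' -> eval_word e' r = 1.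
  rewrite !mem_cat => /or4P[/mapP[r' rr ->]|/predU1P[->|//]|/mapP[p _ ->]|/mapP[j]].
  - by rewrite eval_up (presents_relator presH).
  - by rewrite eval_word_cat e'_r eval_up -l0E.
  - by rewrite eval_word_cat eval_word_inv eval_word_cat FE e'_r eval_up mulgV.
  - rewrite mem_filter => /andP[/asboolP Hj _] ->.
    by rewrite eval_word_cat eval_word_inv e'_r eval_up UE // mulgV.
exists (g + k)%N, rels', e'.
apply: (presents_overgroup presH e'_l) => [r rr| //|w|x].
- by rewrite mem_cat rr.
- have [j [u wE]] := nf w; rewrite (pres_eq_eval rels'1 wE) eval_word_cat e'_r eval_up.
  have Hu : H (eval_word e u) by apply/presH.1; exists u.
  move/(subgroupMr gH Hu) => Hj; exists (U j ++ u).
  by apply: pres_trans wE _; rewrite map_word_cat; apply/pres_catr/R2P.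
- split=> // _; have [[j u] ->] := yP x.
  by exists (c j ++ up u); rewrite eval_word_cat e'_r eval_up.
Qed.

End FiniteIndexOvergroup.

Local Open Scope ring_scope.

(** * Rational homology in degree one *)

Lemma freeg_scale1 (K : choiceType) (k : rat) (x : K) :
  << k *g x >> = k *: << x >> :> {freeg K / rat}.
Proof. by apply/eqP/freeg_eqP => y; rewrite coeffZ !coeffU mul1r. Qed.

Lemma freeg_lin_ind (K : choiceType) (P : {freeg K / rat} -> Prop) :
  P 0 -> (forall k x D, P D -> P (k *: << x >> + D)) -> forall D, P D.
Proof.
by move=> P0 PD; elim/freeg_ind_dom0 => // k x D _ _; rewrite freeg_scale1; apply: PD.
Qed.

Lemma fglift_linear (K : choiceType) (M : lmodType rat) (f : K -> M) : linear (fglift f).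
Proof.
have fB := lift_is_additive f.
have f0 : fglift f 0 = 0 by rewrite -[0 in LHS](subrr 0) fB subrr.
have fD D E : fglift f (D + E) = fglift f D + fglift f E.
  by rewrite -[E in LHS]opprK -[- E]sub0r !fB f0 sub0r opprK.
suff fZ a D : fglift f (a *: D) = a *: fglift f D by move=> a D E; rewrite fD fZ.
elim/freeg_lin_ind: D => [|k x D IHD]; first by rewrite scaler0 f0 scaler0.
rewrite scalerDr !fD IHD scalerDr; congr (_ + _).
by rewrite scalerA -!freeg_scale1 !liftU scalerA.
Qed.

Section LinearRange.
Variables (U V : lmodType rat) (f : U -> V).
Hypothesis f_linear : linear f.

Lemma linear_range0 : range f 0.
Proof. by exists 0 => //; have := f_linear (-1) 0 0; rewrite scaler0 addr0 scaleN1r addNr. Qed.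

Lemma linear_rangeP a x y : range f x -> range f y -> range f (a *: x + y).
Proof. by move=> [u _ <-] [v _ <-]; exists (a *: u + v); rewrite ?f_linear. Qed.

Lemma linear_rangeB x y : range f x -> range f y -> range f (x - y).
Proof. by move=> Wx Wy; rewrite addrC -scaleN1r; apply: linear_rangeP. Qed.

End LinearRange.

(** The map phi sends x to the coordinates of the class of [x] in the rational homology. A
    homomorphism to Q extends linearly to chains, kills boundaries, and so factors through these
    coordinates. *)
Lemma betti1_coordinates (G : groupType) (b : nat) : betti1 G b ->
  exists phi : G -> 'rV[rat]_b,
    [/\ forall x y, phi (x * y)%g = phi x + phi y,
        forall c : 'cV_b, (forall x, phi x *m c = 0) -> c = 0
      & forall f : G -> rat, (forall x y, f (x * y)%g = f x + f y) ->
          exists c : 'cV_b, forall x, f x = (phi x *m c) 0 0].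
Proof.
move=> [v [gen ind]].
have d_lin := fglift_linear
  (fun p : G * G => << p.2 >> - << (p.1 * p.2)%g >> + << p.1 >> : {freeg G / rat}).
pose W := range (@bar_boundary2 G).
have /choice[cc ccW] := gen.
have cc_uniq D c : W (D - \sum_i c i *: v i) -> cc D =1 c.
  move=> Wc i; apply/eqP; rewrite -subr_eq0; apply/eqP.
  move: i; apply: ind; have := linear_rangeB d_lin Wc (ccW D).
  rewrite opprB [X in _ X]addrC addrA subrK -sumrB.
  by congr (_ _); apply: eq_bigr => i _; rewrite scalerBl.
have ccP a D E i : cc (a *: D + E) i = a * cc D i + cc E i.
  move: i; apply: cc_uniq.
  have := linear_rangeP d_lin a (ccW D) (ccW E).
  congr (_ _); rewrite scalerBr addrACA; congr (_ + _).
  rewrite -opprD; congr (- _); rewrite scaler_sumr -big_split.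
  by apply: eq_bigr => i _; rewrite /= scalerDl scalerA.
have cc0 i : cc 0 i = 0.
  move: i; apply: cc_uniq; rewrite big1 ?subrr => [|i _]; last by rewrite scale0r.
  exact: linear_range0 d_lin.
have ccD D E i : cc (D + E) i = cc D i + cc E i by rewrite -[D]scale1r ccP scale1r mul1r.
have ccN D i : cc (- D) i = - cc D i.
  by rewrite -[- D]addr0 -scaleN1r ccP cc0 addr0 mulN1r.
pose phi (x : G) := \row_i cc << x >> i.
exists phi; split.
- move=> x y; apply/rowP => i; rewrite !mxE.
  (* Additivity of phi is the boundary of [x|y]. *)
  have Wxy : W (<< y >> - << (x * y)%g >> + << x >>).
    by exists << (x, y) >> => //; rewrite /bar_boundary2 liftU scale1r.
  have : cc (<< y >> - << (x * y)%g >> + << x >>) i = 0.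
    by move: i; apply: cc_uniq; rewrite big1 ?subr0 // => i _; rewrite scale0r.
  rewrite !ccD ccN => /eqP; rewrite addrAC subr_eq0 => /eqP <-.
  by rewrite addrC.
- move=> c phi0.
  (* The functional c vanishes on generators, hence on all chains; at the basis vector [v j] it
     takes the value of its j-th entry. *)
  have cc_c D : \sum_i cc D i * c i 0 = 0.
    elim/freeg_lin_ind: D => [|k x D IHD]; first by rewrite big1 // => i _; rewrite cc0 mul0r.
    under eq_bigr => i _ do rewrite ccP mulrDl -mulrA.
    rewrite big_split /= -mulr_sumr IHD addr0.
    have /matrixP/(_ 0 0) := phi0 x; rewrite !mxE.
    by under eq_bigr => i _ do rewrite mxE; move=> ->; rewrite mulr0.
  apply/colP => j; rewrite mxE -(cc_c (v j)).
  have ccv : cc (v j) =1 fun i => (i == j)%:R.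
    apply: cc_uniq; rewrite (bigD1 j) //= eqxx scale1r big1 ?addr0 ?subrr.
      exact: linear_range0 d_lin.
    by move=> i /negPf->; rewrite scale0r.
  rewrite (bigD1 j) //= ccv eqxx mul1r big1 ?addr0 // => i /negPf ij.
  by rewrite ccv ij mul0r.
- move=> f fM.
  have L_lin := fglift_linear (f : G -> rat^o).
  set L := fglift _ in L_lin.
  have L0 : L 0 = 0.
    by have := L_lin (-1) 0 0; rewrite scaler0 addr0 scaleN1r addNr.
  have LD D E : L (D + E) = L D + L E by have := L_lin 1 D E; rewrite !scale1r.
  have LN D : L (- D) = - L D by have := L_lin (-1) D 0; rewrite !scaleN1r L0 !addr0.
  have Lf x : L << x >> = f x by rewrite /L liftU scale1r.
  have LW D : W D -> L D = 0.
    move=> [p _ <-]; elim/freeg_lin_ind: p => [|k [x y] p IHp].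
      have -> : bar_boundary2 0 = 0 :> {freeg G / rat}; last exact: L0.
      by have := d_lin (-1) 0 0; rewrite scaler0 addr0 scaleN1r addNr.
    rewrite /bar_boundary2 d_lin L_lin IHp addr0 liftU scale1r !LD LN !Lf fM /=.
    by rewrite opprD addrCA subrr addr0 addNr scaler0.
  exists (\col_i L (v i)) => x; rewrite mxE.
  have := LW _ (ccW << x >>); rewrite LD LN Lf => /eqP; rewrite subr_eq0 => /eqP ->.
  rewrite (big_morph L LD L0); apply: eq_bigr => i _; rewrite !mxE.
  by have := L_lin (cc << x >> i) (v i) 0; rewrite addr0 L0 addr0.
Qed.

(** * Deficiency *)

Lemma card_ltn_pairs b : #|[set p : 'I_b * 'I_b | (p.1 < p.2)%N]%SET| = 'C(b, 2).
Proof.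
rewrite -sum1dep_card -(pair_big_dep xpredT (fun j i : 'I_b => (j < i)%N) (fun _ _ => 1%N)) /=.
rewrite (exchange_big_dep xpredT) //= -bin2_sum big_mkord; apply: eq_bigr => i _.
by rewrite -(big_ord_widen _ (fun=> 1%N) (ltnW (ltn_ord i))) sum_nat_const card_ord muln1.
Qed.

(** The target is a bare type because one of the maps to be factored is additive only up to a
    cocycle. *)
Lemma presents_factor (G : groupType) g (rels : seq (word g)) (e : 'I_g -> G)
    (T : Type) (F : word g -> T) :
  presents rels e -> (forall u v, pres_eq rels u v -> F u = F v) ->
  exists f : G -> T, forall w, f (eval_word e w) = F w.
Proof.
move=> [gen eqP] F_inv; have /choice[nf nfE] := gen.
by exists (F \o nf) => w; apply/F_inv/eqP.
Qed.

(** * The cocycle of the exterior square *)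

Section Cocycle.
Variables (b : nat).
Notation pairs := [set p : 'I_b * 'I_b | (p.1 < p.2)%N]%SET.
Implicit Types x y z : 'rV[rat]_b.

(* The coordinates of x (x) y above the diagonal: a 2-cocycle whose
   antisymmetrization is the exterior product. *)
Definition upper_tensor x y : 'rV[rat]_#|pairs| :=
  \row_k (x 0 (enum_val k).1 * y 0 (enum_val k).2).

Lemma upper_tensorDl x y z : upper_tensor (x + y) z = upper_tensor x z + upper_tensor y z.
Proof. by apply/rowP => k; rewrite !mxE mulrDl. Qed.

Lemma upper_tensorDr x y z : upper_tensor x (y + z) = upper_tensor x y + upper_tensor x z.
Proof. by apply/rowP => k; rewrite !mxE mulrDr. Qed.

Lemma upper_tensorZl a x y : upper_tensor (a *: x) y = a *: upper_tensor x y.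
Proof. by apply/rowP => k; rewrite !mxE mulrA. Qed.

Lemma upper_tensorZr a x y : upper_tensor x (a *: y) = a *: upper_tensor x y.
Proof. by apply/rowP => k; rewrite !mxE mulrCA. Qed.

Lemma upper_tensor0l y : upper_tensor 0 y = 0.
Proof. by apply/rowP => k; rewrite !mxE mul0r. Qed.

Lemma upper_tensor0r x : upper_tensor x 0 = 0.
Proof. by apply/rowP => k; rewrite !mxE mulr0. Qed.

Lemma upper_tensorNr x y : upper_tensor x (- y) = - upper_tensor x y.
Proof. by apply/rowP => k; rewrite !mxE mulrN. Qed.

Lemma upper_tensorNl x y : upper_tensor (- x) y = - upper_tensor x y.
Proof. by apply/rowP => k; rewrite !mxE mulNr. Qed.

(** These are the basis vectors of the exterior square: the reversed product has its only entry
    below the diagonal, where no coordinate is kept. *)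
Lemma upper_tensor_delta (k : 'I_#|pairs|) :
  upper_tensor (delta_mx 0 (enum_val k).1) (delta_mx 0 (enum_val k).2) -
  upper_tensor (delta_mx 0 (enum_val k).2) (delta_mx 0 (enum_val k).1) = delta_mx 0 k.
Proof.
apply/rowP => l; rewrite !mxE /= -!natrM !mulnb.
have := enum_valP k; have := enum_valP l; rewrite !inE => ltl ltk.
have -> : ((enum_val l).1 == (enum_val k).2) && ((enum_val l).2 == (enum_val k).1) = false.
  apply/negbTE/negP => /andP[/eqP E1 /eqP E2]; rewrite E1 E2 in ltl.
  by have := ltn_trans ltl ltk; rewrite ltnn.
rewrite subr0 -(inj_eq enum_val_inj l k).
by case: (enum_val l) (enum_val k) => [? ?] [? ?]; rewrite xpair_eqE.
Qed.

End Cocycle.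

(** * Lifting a presentation to the central extension *)

Section Lift.
Variables (G : groupType) (b : nat) (phi : G -> 'rV[rat]_b).
Hypothesis phiM : forall x y, phi (x * y)%g = phi x + phi y.
Hypothesis phi_sep : forall c : 'cV_b, (forall x, phi x *m c = 0) -> c = 0.
Hypothesis phi_univ : forall f : G -> rat, (forall x y, f (x * y)%g = f x + f y) ->
  exists c : 'cV_b, forall x, f x = (phi x *m c) 0 0.
Variables (g : nat) (rels : seq (word g)) (e : 'I_g -> G).
Hypothesis presG : presents rels e.
Notation r := (size rels).
Notation N := #|[set p : 'I_b * 'I_b | (p.1 < p.2)%N]%SET|.
Implicit Types u v w : word g.

Let phi1 : phi 1%g = 0.
Proof. by apply: (addrI (phi 1%g)); rewrite -phiM mulg1 addr0. Qed.

Let phiV x : phi x^-1%g = - phi x.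
Proof. by apply: (addrI (phi x)); rewrite -phiM mulgV phi1 subrr. Qed.

Definition exponents w : 'rV[rat]_g := \sum_(a <- w) (-1) ^+ a.2 *: delta_mx 0 a.1.

Lemma exponents_cat u v : exponents (u ++ v) = exponents u + exponents v.
Proof. exact: big_cat. Qed.

Definition relation_mx : 'M[rat]_(r, g) := \matrix_j exponents (nth [::] rels j).

(** The correction c sees only values in G, and an inserted or deleted piece has value 1, so
    invariance need only be tested on that piece. *)
Let pres_inv (T : zmodType) (F : word g -> T) (c : G -> G -> T) :
  (forall u v, F (u ++ v) = F u + F v + c (eval_word e u) (eval_word e v)) ->
  (forall x, c x 1%g = 0) -> (forall x, c 1%g x = 0) ->
  (forall i s, F [:: (i, s); (i, ~~ s)] = 0) ->
  (forall w, w \in rels -> F w = 0) ->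
  forall u v, pres_eq rels u v -> F u = F v.
Proof.
move=> FM c1r c1l Fcancel Frel u v; elim=> {u v}.
- by [].
- by move=> u v _ ->.
- by move=> u v w _ -> _ ->.
- move=> u v i s.
  have val1 : eval_word e [:: (i, s); (i, ~~ s)] = 1%g.
    have := (presG.2 [:: (i, s); (i, ~~ s)] [::]).2 (pres_cancel _ [::] [::] _ _).
    by rewrite eval_word_nil.
  by rewrite !FM Fcancel add0r eval_word_cat val1 c1l addr0 mul1g.
- move=> u v w ww.
  have val1 : eval_word e w = 1%g.
    by have := (presG.2 w [::]).2 (pres_mem ww); rewrite eval_word_nil.
  by rewrite !FM (Frel w ww) add0r eval_word_cat val1 c1l addr0 mul1g.
Qed.

(** A vector killed by all relators assigns values to the generators that define a homomorphism to
    Q. It factors through phi, so the kernel has dimension at most b. *)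
Lemma relation_mx_rank : (g <= b + \rank relation_mx)%N.
Proof.
pose A : 'M[rat]_(g, b) := \matrix_i phi (e i).
have kerA : (kermx relation_mx^T <= A^T)%MS.
  apply/rV_subP => l /sub_kermxP lE.
  pose F w := (exponents w *m l^T) 0 0.
  have FM u v : F (u ++ v) = F u + F v + 0 by rewrite addr0 /F exponents_cat mulmxDl mxE.
  have F_inv u v : pres_eq rels u v -> F u = F v.
    apply: (@pres_inv _ F (fun _ _ => 0) FM) => // [i s|w ww].
      rewrite /F /exponents !big_cons big_nil addr0 /= -scalerDl.
      by case: s; rewrite /= ?expr1 ?expr0 ?subrr ?addNr scale0r mul0mx mxE.
    have wr : (index w rels < r)%N by rewrite index_mem.
    have := congr1 (fun M : 'rV_r => M 0 (Ordinal wr)) lE; rewrite [in RHS]mxE => <-.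
    rewrite /F !mxE; apply: eq_bigr => k _.
    by rewrite !mxE /= nth_index // mulrC.
  have [f fE] := presents_factor presG F_inv.
  have [c cE] : exists c : 'cV_b, forall x, f x = (phi x *m c) 0 0.
    apply: phi_univ => x y; have [u <-] := presG.1 x; have [v <-] := presG.1 y.
    by rewrite -eval_word_cat !fE FM addr0.
  suff -> : l = c^T *m A^T by exact: submxMl.
  rewrite -trmx_mul; apply/rowP => i; rewrite mxE.
  have := cE (e i); rewrite -[e i in LHS](eval_word_letter e i false) fE /F.
  rewrite /exponents big_seq1 /= expr0 scale1r -rowE !mxE => ->.
  by apply: eq_bigr => k _; rewrite !mxE.
have := mxrankS kerA; rewrite mxrank_ker !mxrank_tr leq_subLR => /leq_trans; apply.
by rewrite addnC leq_add2r rank_leq_col.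
Qed.

(* The central coordinate of w in the extension of Q^b by the cocycle
   upper_tensor, where x_i is lifted to (phi (e i), 0). *)
Fixpoint cocycle_lift w : 'rV[rat]_N :=
  if w is a :: w' then
    (if a.2 then upper_tensor (phi (e a.1)) (phi (e a.1)) else 0) + cocycle_lift w' +
      upper_tensor (phi (eval_word e [:: a])) (phi (eval_word e w'))
  else 0.

Lemma cocycle_lift_cat u v :
  cocycle_lift (u ++ v) = cocycle_lift u + cocycle_lift v +
    upper_tensor (phi (eval_word e u)) (phi (eval_word e v)).
Proof.
elim: u => [|a u IHu]; first by rewrite eval_word_nil phi1 upper_tensor0l add0r addr0.
rewrite /= {}IHu -[a :: u]cat1s !eval_word_cat !phiM upper_tensorDl upper_tensorDr.
rewrite -!addrA; do 2 congr (_ + _).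
by rewrite (addrC (upper_tensor (phi (eval_word e u)) _)) -!addrA [LHS]addrCA.
Qed.

(** In the extension, (x, 0) has inverse (-x, x (x) x); hence the extra term at inverse letters. *)
Lemma cocycle_lift_cancel i s : cocycle_lift [:: (i, s); (i, ~~ s)] = 0.
Proof.
rewrite /= eval_word_nil phi1 upper_tensor0r !eval_word_letter /=.
by case: s; rewrite /= !(add0r, addr0) phiV ?(upper_tensorNl, upper_tensorNr) subrr.
Qed.

Definition cocycle_obstruction : 'M[rat]_(r, N) :=
  \matrix_j cocycle_lift (nth [::] rels j).

(* The rows of T are the forms on the centre whose values at the relators lie in
   the image of the exponent matrix: with central coordinates L for the
   generators, all relators become trivial. *)
Lemma central_quotient :
  exists (D : nat) (T : 'M[rat]_(D, N)) (q : G -> 'rV_D),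
    [/\ row_free T, (N + \rank relation_mx <= D + r)%N
      & forall x y, q (x * y)%g = q x + q y + upper_tensor (phi x) (phi y) *m T^T].
Proof.
(* The cokernel factor reduces the central values of the relators modulo the image of the exponent
   matrix; T spans the forms that then vanish. *)
pose X := cocycle_obstruction^T *m cokermx relation_mx^T.
pose T := row_base (kermx X).
have T_free : row_free T := row_base_free _.
have /submxP[L TL] : (T *m cocycle_obstruction^T <= relation_mx^T)%MS.
  rewrite submxE -mulmxA; by apply/eqP/sub_kermxP; rewrite eq_row_base.
clearbody T; pose F w := cocycle_lift w *m T^T - exponents w *m L^T.
have FM u v : F (u ++ v) = F u + F v +
    upper_tensor (phi (eval_word e u)) (phi (eval_word e v)) *m T^T.
  rewrite /F cocycle_lift_cat exponents_cat !mulmxDl opprD.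
  by rewrite addrAC; congr (_ + _); exact: addrACA.
have F_inv u v : pres_eq rels u v -> F u = F v.
  apply: (@pres_inv _ F (fun x y => upper_tensor (phi x) (phi y) *m T^T) FM).
  - by move=> x; rewrite phi1 upper_tensor0r mul0mx.
  - by move=> x; rewrite phi1 upper_tensor0l mul0mx.
  - move=> i s; rewrite /F cocycle_lift_cancel /exponents !big_cons big_nil addr0 /= -scalerDl.
    by case: s; rewrite /= ?expr1 ?expr0 ?subrr ?addNr scale0r !mul0mx subrr.
  - move=> w ww; have wr : (index w rels < r)%N by rewrite index_mem.
    have := congr1 (fun M : 'M_(_, r) => row (Ordinal wr) M^T) TL.
    rewrite (trmx_mul T) (trmx_mul L) !trmxK !row_mul !rowK /= nth_index // /F => ->.
    exact: subrr.
have [q qE] := presents_factor presG F_inv.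
exists _, T, q; split=> //.
  (* D is N minus the rank of X, which is at most r minus the rank of the exponent matrix. *)
  rewrite mxrank_ker.
  have := mxrankM_maxr cocycle_obstruction^T (cokermx relation_mx^T).
  rewrite -/X mxrank_coker mxrank_tr => rX.
  have := rank_leq_row X; have := rank_leq_row relation_mx.
  by move: rX; lia.
move=> x y; have [u <-] := presG.1 x; have [v <-] := presG.1 y.
by rewrite -eval_word_cat !qE FM.
Qed.

(** The image of phi spans Q^b, by [phi_sep]. This extends identities from that image to the whole
    space. *)
Lemma sep_functional (l : 'rV[rat]_b -> rat) :
  (forall a x y, l (a *: x + y) = a * l x + l y) -> (forall x, l (phi x) = 0) ->
  forall x, l x = 0.
Proof.
move=> lP l0.
have l00 : l 0 = 0 by have := lP (-1) 0 0; rewrite scaler0 addr0 mulN1r addNr.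
have lE x : l x = (x *m (\col_i l (delta_mx 0 i))) 0 0.
  rewrite mxE {1}[x]row_sum_delta.
  have lD y z : l (y + z) = l y + l z by have := lP 1 y z; rewrite scale1r mul1r.
  rewrite (big_morph l lD l00); apply: eq_bigr => i _; rewrite mxE.
  by have := lP (x 0 i) (delta_mx 0 i) 0; rewrite !addr0 l00 addr0.
move=> x; rewrite lE (phi_sep (c := \col_i l (delta_mx 0 i))) ?mulmx0 ?mxE // => y.
by apply/rowP => i; rewrite ord1 -lE l0 mxE.
Qed.

(** The coordinates of phi contribute b to the height; on the kernel of phi the map q becomes
    additive, and commutators make its D coordinates independent. *)
Lemma presentation_tall : exists2 k : nat, tall k [set: G] & (g + 'C(b, 2) <= k + r)%N.
Proof.
have [D [T [q [T_free leD qM]]]] := central_quotient.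
exists (b + (D + 0))%N; last first.
  by have := relation_mx_rank; rewrite card_ltn_pairs in leD; lia.
pose K : set G := [set: G] `&` [set x | forall i, phi x 0 i = 0].
have K0 x : K x -> phi x = 0 by move=> [_ Kx]; apply/rowP => i; rewrite mxE.
have gK : is_subgroup K.
  split=> [|x y /K0 Kx /K0 Ky]; first by split=> // i; rewrite phi1 mxE.
  by split=> // i; rewrite phiM phiV Kx Ky subr0 mxE.
apply: (@tall_add_homs _ _ _ _ (fun i x => phi x 0 i)) => // [i x y _ _|c c0 i|].
- by rewrite phiM mxE.
- suff /matrixP/(_ i 0) : \col_i c i = 0 by rewrite !mxE.
  apply: phi_sep => x; apply/rowP => j; rewrite ord1 !mxE -[RHS](c0 x) //.
  by apply: eq_bigr => k _; rewrite mxE mulrC.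
rewrite -/K; apply: (@tall_add_homs _ _ _ _ (fun i x => q x 0 i)) => // [i x y Kx Ky|c c0|].
- by rewrite qM (K0 _ Kx) upper_tensor0l mul0mx addr0 mxE.
(* The relation c among the coordinates of q becomes a form d on the exterior square, and B is the
   alternating form it defines. *)
- pose d := T^T *m \col_k c k.
  pose B x y := ((upper_tensor x y - upper_tensor y x) *m d) 0 0.
  have Bphi x y : B (phi x) (phi y) = 0.
    pose z := (x * y * (y * x)^-1)%g.
    have Kz : K z by split=> // i; rewrite phiM phiV !phiM [phi y + _]addrC subrr mxE.
    (* On a commutator, q is the exterior product of the two images, seen through T. *)
    have qz : q z = (upper_tensor (phi x) (phi y) - upper_tensor (phi y) (phi x)) *m T^T.
      have := qM z (y * x)%g; rewrite (K0 _ Kz) upper_tensor0l mul0mx addr0 /z mulgVK -/z.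
      move/esym/(canRL (addrK _)) ->; rewrite !qM opprD mulmxBl.
      by rewrite [q y + _]addrC addrACA subrr add0r.
    rewrite /B /d mulmxA -qz mxE -[RHS](c0 z Kz).
    by apply: eq_bigr => k _; rewrite mxE mulrC.
  have BDl a x y z : B (a *: x + y) z = a * B x z + B y z.
    rewrite /B upper_tensorDl upper_tensorDr upper_tensorZl upper_tensorZr.
    by rewrite opprD addrACA -scalerBr mulmxDl -scalemxAl !mxE.
  have BC x y : B x y = - B y x by rewrite /B -opprB mulNmx mxE.
  (* B vanishes on the image of phi; spanning is applied in each variable in turn. *)
  have B0 x y : B x y = 0.
    move: x; apply: (sep_functional (l := B^~ y)) => [a x z|x]; first exact: BDl.
    rewrite BC; apply/eqP; rewrite oppr_eq0; apply/eqP; move: y.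
    by apply: (sep_functional (l := B^~ (phi x))) => [a y z|y]; [exact: BDl|exact: Bphi].
  have d0 : d = 0.
    apply/colP => k; rewrite [RHS]mxE.
    have := B0 (delta_mx 0 (enum_val k).1) (delta_mx 0 (enum_val k).2).
    by rewrite /B upper_tensor_delta -rowE [in LHS]mxE.
  have c0' : (\col_k c k)^T = 0.
    by apply: (row_free_inj T_free); rewrite mul0mx -[T in LHS]trmxK -trmx_mul -/d d0 trmx0.
  by move=> k; have /rowP/(_ k) := c0'; rewrite !mxE.
have KhomM : add_hom_on K q.
  by move=> x y Kx Ky; rewrite qM (K0 _ Kx) upper_tensor0l mul0mx addr0.
have -> : K `&` [set x | forall i, q x 0 i = 0] = K `&` [set x | q x = 0].
  apply/seteqP; split=> x [Kx /= qx]; split=> //=; last by move=> i; rewrite qx mxE.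
  by apply/rowP => i; rewrite qx mxE.
exact: subgroup_ker.
Qed.

End Lift.

Lemma deficiency_bound (G : groupType) n b g r :
  hirsch_length G n -> betti1 G b -> has_presentation G g r -> (g + 'C(b, 2) <= n + r)%N.
Proof.
move=> Gn /betti1_coordinates[phi [phiM phi_sep phi_univ]] [rels [e presG]].
have [k /(hirsch_tall Gn) kn] := presentation_tall phiM phi_sep phi_univ presG.
by rewrite size_tuple => /leq_trans; apply; rewrite leq_add2r.
Qed.

Lemma has_presentation_seq (G : groupType) g (rels : seq (word g)) (e : 'I_g -> G) :
  presents_subgroup [set: G] rels e -> has_presentation G g (size rels).
Proof. by move=> /presents_setT presG; exists (in_tuple rels), e. Qed.

Lemma virtually_polyZ_presentation (G : groupType) :
  virtually_polyZ G -> exists g r, has_presentation G g r.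
Proof.
move=> [H fiH [n /polyZ_presentation[rels [e [_ presH]]]]].
have [g [rels' [e' presG]]] := finite_index_presentation presH fiH.
by exists g, (size rels'); apply: has_presentation_seq presG.
Qed.

(** The gap between B and g - r is a natural number, and a least gap gives the maximum. *)
Lemma exists_deficiency (G : groupType) (B : int) :
  (exists g r, has_presentation G g r) ->
  (forall g r, has_presentation G g r -> g%:Z - r%:Z <= B) ->
  exists d, is_deficiency G d.
Proof.
move=> [g0 [r0 pres0]] leB.
pose P k := `[< exists g r, has_presentation G g r /\ B - k%:Z = g%:Z - r%:Z >].
have gap g r : has_presentation G g r -> P (absz (B - (g%:Z - r%:Z))%R).
  by move=> pres; apply/asboolP; exists g, r; split=> //; have := leB _ _ pres; lia.
have exP : exists k, P k by exists (absz (B - (g0%:Z - r0%:Z))%R); apply: gap.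
have [k /asboolP[g [r [pres kE]]] k_min] := ex_minnP exP.
exists (B - k%:Z); split=> [|g' r' pres']; first by exists g, r.
by have := k_min _ (gap _ _ pres'); have := leB _ _ pres'; lia.
Qed.

Theorem mainTheorem5 (pi : groupType) (n beta : nat)
    (pi_tf : torsion_free pi)
    (pi_vpZ : virtually_polyZ pi)
    (pi_n : hirsch_length pi n)
    (pi_beta : betti1 pi beta) :
  exists d : int,
    [/\ is_deficiency pi d,
        d <= n%:Z - 'C(beta, 2)%:Z
      & polyZ pi ->
          has_presentation pi n 'C(n, 2) /\ n%:Z - 'C(n, 2)%:Z <= d].
Proof.
have le_def g r : has_presentation pi g r -> g%:Z - r%:Z <= n%:Z - 'C(beta, 2)%:Z.
  by move=> /(deficiency_bound pi_n pi_beta); lia.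
have [d [[g [r [pres dE]]] d_max]] :=
  exists_deficiency (virtually_polyZ_presentation pi_vpZ) le_def.
exists d; split; [by split=> //; exists g, r | by rewrite dE; apply: le_def |].
move=> [m Zm]; have mn := hirsch_polyZ pi_n Zm; subst m.
have [rels [e [<- /has_presentation_seq presn]]] := polyZ_presentation Zm.
by split=> //; apply: d_max.
Qed.
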